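(* Let $H$ be a Hamiltonian (Hermitian operator) on a finite-dimensional Hilbert space with maximum eigenvalue $E_{\max}$, let $\beta=1/(k_BT)>0$, $Z(\beta)=\mathrm{Tr}\,e^{-\beta H}$, $\gamma_\beta=e^{-\beta H}/Z(\beta)$, and $F(\beta)=-\beta^{-1}\ln Z(\beta)$. Let $\rho$ be a state with $[\rho,\gamma_\beta]=0$. Then $$S(\gamma_\beta)-S(\rho)\ \ge\ \frac{1}{k_BT}\big[\langle H\rangle_{\gamma_\beta}-\langle H\rangle_\rho\big]+\frac{C(\rho\|\gamma_\beta)}{2\sqrt{M^{(2)}_{1,s_{\min}}(\rho\|\gamma_\beta)}}\ \ge\ \frac{1}{k_BT}\big[\langle H\rangle_{\gamma_\beta}-\langle H\rangle_\rho\big]+\frac{C(\rho\|\gamma_\beta)}{2+2\beta\,(E_{\max}-F(\beta))},$$ where $s_{\min}=e^{-\beta E_{\max}}/Z(\beta)$ is the smallest eigenvalue of $\gamma_\beta$.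
   Context: $S(\rho)=-\mathrm{Tr}(\rho\ln\rho)$, $\langle H\rangle_\rho=\mathrm{Tr}(\rho H)$, $S(\rho\|\sigma)=\mathrm{Tr}[\rho(\ln\rho-\ln\sigma)]$, $C(\rho\|\sigma)=\mathrm{Tr}[\rho(\ln\rho-\ln\sigma)^2]-S(\rho\|\sigma)^2$, and $M^{(2)}_{1,x}(\rho\|\sigma)=C(\rho\|\sigma)+\big(1-\ln x-S(\rho\|\sigma)\big)^2$ for $x>0$. Zero eigenvalues of $\rho$ contribute $0$ to all traces. *)

(* Defs.v *)
From HB Require Import structures.
From mathcomp Require Import all_boot all_order all_algebra.
From mathcomp Require Import sesquilinear spectral.
From mathcomp Require Import reals sequences exp complex.

Set Implicit Arguments.
Unset Strict Implicit.
Unset Printing Implicit Defensive.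

Import Order.TTheory GRing.Theory Num.Theory.
Local Open Scope ring_scope.
Local Open Scope complex_scope.
Local Open Scope sesquilinear_scope.

(* Operators on an n-dimensional complex Hilbert space are matrices over R[i];
   operators that are Hermitian with respect to the standard inner product
   satisfy [A \is hermsymmx]. *)

(* Functional calculus f(A) = U^* diag(f(a_1), ..., f(a_n)) U for a Hermitian
   A = U^* diag(a_1, ..., a_n) U; [spectralmx A] is unitary and the a_i are
   real, so nothing is lost by taking real parts. *)
Definition mxfun (R : realType) (n : nat) (f : R -> R) (A : 'M[R[i]]_n) :
    'M[R[i]]_n :=
  invmx (spectralmx A)
    *m diag_mx (map_mx (fun a : R[i] => (f (complex.Re a))%:C)
                       (spectral_diag A))
    *m spectralmx A.

Definition mxexp (R : realType) (n : nat) (A : 'M[R[i]]_n) : 'M[R[i]]_n :=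
  mxfun (@expR R) A.

(* Since [ln 0 = 0], zero eigenvalues of A contribute 0. *)
Definition mxln (R : realType) (n : nat) (A : 'M[R[i]]_n) : 'M[R[i]]_n :=
  mxfun (@ln R) A.

(* All the traces below are real, because each is the trace of a product A B
   with A and B Hermitian. *)
Definition Rtr (R : realType) (n : nat) (A : 'M[R[i]]_n) : R :=
  complex.Re (\tr A).

Definition is_state (R : realType) (n : nat) (rho : 'M[R[i]]_n) : Prop :=
  [/\ rho \is hermsymmx,
      (forall v : 'cV[R[i]]_n, 0 <= (v ^t* *m rho *m v) 0 0)
    & \tr rho = 1].

Definition is_max_eigenvalue (R : realType) (n : nat) (A : 'M[R[i]]_n)
    (e : R) : Prop :=
  eigenvalue A e%:C /\ (forall a : R[i], eigenvalue A a -> a <= e%:C).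

Definition is_min_eigenvalue (R : realType) (n : nat) (A : 'M[R[i]]_n)
    (e : R) : Prop :=
  eigenvalue A e%:C /\ (forall a : R[i], eigenvalue A a -> e%:C <= a).

Definition vn_entropy (R : realType) (n : nat) (rho : 'M[R[i]]_n) : R :=
  - Rtr (rho *m mxln rho).

Definition expectation (R : realType) (n : nat) (H rho : 'M[R[i]]_n) : R :=
  Rtr (rho *m H).

Definition rel_entropy (R : realType) (n : nat) (rho sigma : 'M[R[i]]_n) : R :=
  Rtr (rho *m (mxln rho - mxln sigma)).

Definition rel_variance (R : realType) (n : nat) (rho sigma : 'M[R[i]]_n) : R :=
  Rtr (rho *m ((mxln rho - mxln sigma) *m (mxln rho - mxln sigma)))
  - rel_entropy rho sigma ^+ 2.

Definition M2 (R : realType) (n : nat) (x : R) (rho sigma : 'M[R[i]]_n) : R :=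
  rel_variance rho sigma + (1 - ln x - rel_entropy rho sigma) ^+ 2.

Definition partition_fun (R : realType) (n : nat) (H : 'M[R[i]]_n) (beta : R) :
    R :=
  Rtr (mxexp ((- beta)%:C *: H)).

Definition gibbs (R : realType) (n : nat) (H : 'M[R[i]]_n) (beta : R) :
    'M[R[i]]_n :=
  ((partition_fun H beta)^-1)%:C *: mxexp ((- beta)%:C *: H).

Definition free_energy (R : realType) (n : nat) (H : 'M[R[i]]_n) (beta : R) :
    R :=
  - beta^-1 * ln (partition_fun H beta).

(* Main.v *)
Require Import Defs.
From mathcomp Require Import all_boot all_order all_algebra.
From mathcomp Require Import sesquilinear spectral.
From mathcomp Require Import classical_sets reals topology normedtype derive.
From mathcomp Require Import sequences exp complex.
From mathcomp Require Import ring lra.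
Set Implicit Arguments.
Unset Strict Implicit.
Unset Printing Implicit Defensive.
Import Order.TTheory GRing.Theory Num.Theory.
Import numFieldNormedType.Exports.
Local Open Scope ring_scope.
Local Open Scope complex_scope.
Local Open Scope sesquilinear_scope.

(** Diagonalize rho with eigenpairs (p_i, u_i) and gamma with (s_j, v_j). The
    numbers p_i |<u_i, v_j>|^2 form a probability distribution on pairs (i, j),
    and the first two moments of x_ij = ln p_i - ln s_j are D = S(rho || gamma)
    and C(rho || gamma) + D^2. Moreover x <= - ln smin almost surely and
    E[exp(- x)] <= 1.

    Put L = 1 - ln smin and y = L - x >= 1, so that M2 = E[y^2] and
    E[exp(y - L)] <= 1. Since u |-> exp(sqrt u) is convex for u >= 1, its tangent
    at u = L^2 gives sqrt(M2) <= L, which is the second inequality. It also gives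
    D = L - E[y] >= sqrt(M2) - E[y] = C / (sqrt(M2) + E[y]) >= C / (2 sqrt(M2)).
    The first inequality follows because ln gamma = - beta H - ln Z turns
    S(gamma) - S(rho) - beta (<H>_gamma - <H>_rho) into D. *)

(** * Matrices diagonalized in a given basis *)

(** The diagonalizing matrix [U] is a parameter, so any eigenbasis can be used and not only the one
    returned by [spectralmx]. Writing [invmx U] rather than the adjoint keeps the algebra valid over
    every field. *)
Definition conjdiag (F : fieldType) (n : nat) (U : 'M[F]_n) (d : 'I_n -> F) :
    'M[F]_n :=
  invmx U *m diag_mx (\row_k d k) *m U.

Lemma eq_conjdiag (F : fieldType) n (U : 'M[F]_n) d e :
  d =1 e -> conjdiag U d = conjdiag U e.
Proof.
move=> de; rewrite /conjdiag; congr (invmx U *m diag_mx _ *m U).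
by apply/rowP => k; rewrite !mxE.
Qed.

Lemma conjdiagD (F : fieldType) n (U : 'M[F]_n) d e :
  conjdiag U d + conjdiag U e = conjdiag U (fun k => d k + e k).
Proof.
rewrite /conjdiag -mulmxDl -mulmxDr -raddfD.
congr (invmx U *m diag_mx _ *m U).
by apply/rowP => k; rewrite !mxE.
Qed.

Lemma conjdiagZ (F : fieldType) n (U : 'M[F]_n) a d :
  a *: conjdiag U d = conjdiag U (fun k => a * d k).
Proof.
rewrite /conjdiag scalemxAl scalemxAr -linearZ /=.
congr (invmx U *m diag_mx _ *m U).
by apply/rowP => k; rewrite !mxE.
Qed.

Lemma conjdiagM (F : fieldType) n (U : 'M[F]_n) d e : U \in unitmx ->
  conjdiag U d *m conjdiag U e = conjdiag U (fun k => d k * e k).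
Proof.
move=> Uu; rewrite /conjdiag !mulmxA mulmxK//.
rewrite -[X in X *m U]mulmxA mulmx_diag.
congr (invmx U *m diag_mx _ *m U).
by apply/rowP => k; rewrite !mxE.
Qed.

Lemma conjdiag_const (F : fieldType) n (U : 'M[F]_n) a : U \in unitmx ->
  conjdiag U (fun=> a) = a%:M.
Proof.
move=> Uu; rewrite /conjdiag; have -> : diag_mx (\row__ a) = a%:M :> 'M_n.
  by apply/matrixP => i j; rewrite !mxE.
by rewrite mul_mx_scalar -scalemxAl mulVmx// scalemx1.
Qed.

Lemma mxtrace_conjdiag (F : fieldType) n (U : 'M[F]_n) d : U \in unitmx ->
  \tr (conjdiag U d) = \sum_k d k.
Proof.
move=> Uu; rewrite /conjdiag -mulmxA mxtrace_mulC mulmxK// mxtrace_diag.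
by apply: eq_bigr => k _; rewrite mxE.
Qed.

Lemma mul_conjdiag (F : fieldType) n (U : 'M[F]_n) d : U \in unitmx ->
  U *m conjdiag U d = diag_mx (\row_k d k) *m U.
Proof. by move=> Uu; rewrite /conjdiag !mulmxA mulmxV// mul1mx. Qed.

(* Entrywise, an intertwiner of two diagonal matrices vanishes where their
   entries differ, so it still intertwines after applying [f] to both. *)
Lemma diag_mx_intertwiner (F : fieldType) n (f : F -> F) (W : 'M[F]_n) d e :
  W *m diag_mx (\row_k d k) = diag_mx (\row_k e k) *m W ->
  W *m diag_mx (\row_k f (d k)) = diag_mx (\row_k f (e k)) *m W.
Proof.
move=> /matrixP WE; apply/matrixP => i j; have := WE i j.
rewrite !mul_mx_diag !mul_diag_mx !mxE.
have [->|w0] := eqVneq (W i j) 0; first by rewrite !mulr0 !mul0r.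
move=> de; have -> : d j = e i by apply: (mulfI w0); rewrite de mulrC.
exact: mulrC.
Qed.

(** Functional calculus does not depend on the diagonalization: [V *m invmx U] intertwines the two
    diagonal matrices, hence also their images under [f]. *)
Lemma conjdiag_comp (F : fieldType) n (f : F -> F) (U V : 'M[F]_n) d e :
  U \in unitmx -> V \in unitmx -> conjdiag U d = conjdiag V e ->
  conjdiag U (f \o d) = conjdiag V (f \o e).
Proof.
move=> Uu Vu UV; have /(diag_mx_intertwiner f) : V *m invmx U *m
    diag_mx (\row_k d k) = diag_mx (\row_k e k) *m (V *m invmx U).
  have /(congr1 (fun M => V *m M *m invmx U)) := UV.
  by rewrite mul_conjdiag// /conjdiag !mulmxA mulmxK.
move=> /(congr1 (fun M => invmx V *m M *m U)).
by rewrite !mulmxA mulVmx// mul1mx mulmxKV.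
Qed.

(** Eigenvectors are rows here. In the coordinates [v *m invmx U] the matrix is diagonal, and any
    nonzero coordinate [k] forces [a = d k]; conversely row [k] of [U] is an eigenvector for
    [d k]. *)
Lemma eigenvalue_conjdiag (F : fieldType) n (U : 'M[F]_n) d a :
  U \in unitmx -> eigenvalue (conjdiag U d) a <-> exists k, a = d k.
Proof.
move=> Uu; split=> [/eigenvalueP[v vE v0]|[k ->]].
  have : v *m invmx U != 0.
    by apply: contra_neq v0 => /(congr1 (mulmx^~ U)); rewrite mulmxKV// mul0mx.
  have /(congr1 (mulmx^~ (invmx U))) := vE.
  rewrite /conjdiag !mulmxA mulmxK// -scalemxAl mul_mx_diag.
  move: (v *m invmx U) => w /rowP wE /rV0Pn[k wk]; exists k; apply: (mulIf wk).
  by have := wE k; rewrite !mxE => <-; rewrite mulrC.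
apply/eigenvalueP; exists (row k U).
  rewrite -row_mul mul_conjdiag// row_mul row_diag_mx mxE -scalemxAl.
  by rewrite -rowE.
apply/eqP => /(congr1 (mulmx^~ (invmx U))); rewrite -row_mul mulmxV// mul0mx.
by move=> /rowP/(_ k)/eqP; rewrite !mxE eqxx oner_eq0.
Qed.

(** * Traces in two unitary bases and their squared overlaps *)

(** With W = U V^*, cyclicity turns the trace into that of D W E W^*, where D and E are the diagonal
    parts. The entries of W are the inner products of the two bases. *)
Lemma mxtrace_conjdiagM (C : numClosedFieldType) n (U V : 'M[C]_n) d e :
  U \is unitarymx -> V \is unitarymx ->
  \tr (conjdiag U d *m conjdiag V e) =
    \sum_i \sum_j `|(U *m V^t*) i j| ^+ 2 * (d i * e j).
Proof.
move=> Uu Vu; set W := U *m V^t*.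
have VU : V *m U^t* = W^t* by rewrite /W trmx_mul map_mxM trmxCK.
transitivity (\tr (U^t* *m
    (diag_mx (\row_k d k) *m W *m diag_mx (\row_k e k) *m V))).
  by rewrite /conjdiag !invmx_unitary// /W !mulmxA.
rewrite mxtrace_mulC -[X in \tr X]mulmxA VU; move: W {VU} => W.
apply: eq_bigr => i _; rewrite mxE; apply: eq_bigr => j _.
rewrite mul_mx_diag mul_diag_mx !mxE normCK; ring.
Qed.

Lemma unitarymx_row_norm (C : numClosedFieldType) n (W : 'M[C]_n) i :
  W \is unitarymx -> \sum_j `|W i j| ^+ 2 = 1.
Proof.
move=> /unitarymxP/matrixP/(_ i i); rewrite !mxE eqxx mulr1n => <-.
by apply: eq_bigr => j _; rewrite !mxE normCK.
Qed.

Lemma unitarymx_col_norm (C : numClosedFieldType) n (W : 'M[C]_n) j :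
  W \is unitarymx -> \sum_i `|W i j| ^+ 2 = 1.
Proof.
rewrite -trmx_unitary => /(unitarymx_row_norm j) <-.
by apply: eq_bigr => i _; rewrite mxE.
Qed.

Lemma sum_overlap_sqr_row (C : numClosedFieldType) n (U V : 'M[C]_n) i :
  U \is unitarymx -> V \is unitarymx ->
  \sum_j `|(U *m V^t*) i j| ^+ 2 = 1.
Proof.
move=> Uu Vu; apply: unitarymx_row_norm.
by rewrite mul_unitarymx// trmxC_unitary.
Qed.

Lemma sum_overlap_sqr_col (C : numClosedFieldType) n (U V : 'M[C]_n) j :
  U \is unitarymx -> V \is unitarymx ->
  \sum_i `|(U *m V^t*) i j| ^+ 2 = 1.
Proof.
move=> Uu Vu; apply: unitarymx_col_norm.
by rewrite mul_unitarymx// trmxC_unitary.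
Qed.

Lemma conjdiag_form (C : numClosedFieldType) n (U : 'M[C]_n) d k :
  U \is unitarymx -> (row k U *m conjdiag U d *m (row k U)^t*) 0 0 = d k.
Proof.
move=> Uu; have Uv := unitarymx_unit Uu.
rewrite -row_mul mul_conjdiag// row_mul row_diag_mx -scalemxAl -rowE mxE.
have /unitarymxP/matrixP/(_ k k) := Uu; rewrite mxE [RHS]mxE eqxx mulr1n mxE.
under eq_bigr do rewrite !mxE.
move=> UU; under eq_bigr do rewrite !mxE -mulrA.
by rewrite -mulr_sumr UU mulr1.
Qed.

(** Used on the cross term where [M] and [A] share an eigenbasis: cyclicity makes them adjacent, so
    they merge into one [conjdiag]. *)
Lemma mxtrace_mulCA (F : fieldType) n (M A B : 'M[F]_n) :
  \tr (M *m (B *m A)) = \tr (A *m M *m B).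
Proof. by rewrite mulmxA mxtrace_mulC mulmxA. Qed.

Lemma mulmx_sqrB (F : fieldType) n (M A B : 'M[F]_n) :
  M *m ((A - B) *m (A - B)) =
    M *m (A *m A) - M *m (A *m B) - M *m (B *m A) + M *m (B *m B).
Proof.
by rewrite mulmxBl !mulmxBr opprB addrA addrAC.
Qed.

Lemma mxtrace_conjdiag_overlap (C : numClosedFieldType) n (U V : 'M[C]_n) d :
  U \is unitarymx -> V \is unitarymx ->
  \tr (conjdiag U d) = \sum_i \sum_j `|(U *m V^t*) i j| ^+ 2 * d i.
Proof.
move=> Uu Vu; rewrite mxtrace_conjdiag ?unitarymx_unit//.
by apply: eq_bigr => i _; rewrite -mulr_suml sum_overlap_sqr_row// mul1r.
Qed.

(** After expansion and cyclicity, each of the four terms is the trace of one factor diagonal in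
    [U], times at most one factor diagonal in [V]. The overlap formulas then apply, and the square
    reassembles entrywise. *)
Lemma mxtrace_conjdiag_sqrB (C : numClosedFieldType) n (U V : 'M[C]_n) d a b :
  U \is unitarymx -> V \is unitarymx ->
  \tr (conjdiag U d *m ((conjdiag U a - conjdiag V b) *m
                        (conjdiag U a - conjdiag V b))) =
    \sum_i \sum_j `|(U *m V^t*) i j| ^+ 2 * (d i * (a i - b j) ^+ 2).
Proof.
move=> Uu Vu; have Uv := unitarymx_unit Uu; have Vv := unitarymx_unit Vu.
rewrite mulmx_sqrB mxtraceD 2!raddfB /=.
rewrite (mxtrace_mulCA _ (conjdiag U a) (conjdiag V b)).
rewrite (mulmxA _ (conjdiag U a) (conjdiag V b)).
rewrite !(conjdiagM _ _ Uv) (conjdiagM _ _ Vv).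
rewrite (mxtrace_conjdiag_overlap _ Uu Vu) !(mxtrace_conjdiagM _ _ Uu Vu).
rewrite -!sumrB -big_split; apply: eq_bigr => i _ /=.
rewrite -!sumrB -big_split; apply: eq_bigr => j _ /=.
by ring.
Qed.

(** * Scalar inequalities: a tangent bound and its consequence for moments *)

Lemma expR_sqr_tangent (R : realType) (L y : R) :
  1 <= L -> 1 <= y -> 1 + (y ^+ 2 - L ^+ 2) / (2 * L) <= expR (y - L).
Proof.
move=> L1 y1.
have L0 : L != 0 by rewrite gt_eqF//; lra.
(* The claim says that [g] is minimal at [L], where its derivative [dg] vanishes; the mean value
   theorem is applied on each side of [L]. *)
pose g (z : R) := expR (z - L) - z ^+ 2 / (2 * L).
pose dg (z : R) := expR (z - L) - z / L.
have gdrv (z : R) : is_derive z 1 g (dg z).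
  apply: is_derive_eq; rewrite /dg.
  by rewrite scaler0 scaler1 /GRing.scale /=; field.
have gcont (a b : R) : {within `[a, b], continuous g}%classic.
  apply: continuous_subspaceT => z; apply: differentiable_continuous.
  by apply/derivable1_diffP; have [] := gdrv z.
suff : g L <= g y.
  rewrite /g subrr expR0 mulrBl => h; lra.
have [Ly|/ltW yL] := leP L y.
  have [c] := MVT_segment Ly (fun z _ => gdrv z) (gcont L y).
  rewrite in_itv /= => /andP[Lc _] gE; rewrite -subr_ge0 gE.
  (* Here c / L <= 1 + (c - L), since the difference is (c - L) (1 - 1 / L) >= 0. *)
  rewrite mulr_ge0 ?subr_ge0//; apply: le_trans (expR_ge1Dx _).
  rewrite ler_pdivrMr; last lra.
  nra.
have [c] := MVT_segment yL (fun z _ => gdrv z) (gcont y L).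
rewrite in_itv /= => /andP[yc cL] gE; rewrite -subr_le0 gE.
rewrite mulr_le0_ge0 ?subr_ge0// subr_le0.
have c1 : 1 <= c by exact: le_trans yc.
have c0 : 0 < c by lra.
(* Taking reciprocals leaves L / c <= exp(L - c). It follows from L / c <= 1 + (L - c), that is, (L
   - c) (c - 1) >= 0. *)
have -> : expR (c - L) = (expR (L - c))^-1 by rewrite -expRN opprB.
rewrite -[leRHS]invf_div lef_pV2 ?posrE ?expR_gt0 ?divr_gt0//; last by lra.
by apply: le_trans (expR_ge1Dx _); rewrite ler_pdivrMr//; nra.
Qed.

(** The probabilistic core: [D] and [V] are the mean and variance of [x] under the weights [w]. In
    the application [l] is minus the logarithm of the smallest eigenvalue and [m] is the square root
    of [M2]. *)
Lemma exp_moment_variance_bounds (R : realType) (K : finType) (w x : K -> R)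
    (l : R) :
  (forall k, 0 <= w k) -> \sum_k w k = 1 -> 0 <= l ->
  (forall k, w k != 0 -> x k <= l) -> \sum_k w k * expR (- x k) <= 1 ->
  let D := \sum_k w k * x k in
  let V := \sum_k w k * x k ^+ 2 - D ^+ 2 in
  let m := Num.sqrt (V + (1 + l - D) ^+ 2) in
  V / (2 * m) <= D /\ V / (2 * (1 + l)) <= V / (2 * m).
Proof.
move=> w0 w1 l0 xl wexp D V m.
have L1 : 1 <= 1 + l by lra.
have wsum f g : (forall k, w k != 0 -> f k <= g k) ->
    \sum_k w k * f k <= \sum_k w k * g k.
  move=> fg; apply: ler_sum => k _.
  by have [->|wk] := eqVneq (w k) 0; rewrite ?mul0r// ler_wpM2l// fg.
have Dl : D <= l.
  by rewrite /D (le_trans (wsum _ (fun=> l) xl))// -mulr_suml w1 mul1r.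
have V0 : 0 <= V.
  have -> : V = \sum_k w k * (x k - D) ^+ 2.
    under [RHS]eq_bigr => k _ do
      have -> : w k * (x k - D) ^+ 2 =
        w k * x k ^+ 2 - 2 * D * (w k * x k) + D ^+ 2 * w k by ring.
    rewrite big_split/= sumrB -!mulr_sumr w1 -/D /V.
    by ring.
  by apply: sumr_ge0 => k _; rewrite mulr_ge0 ?sqr_ge0.
(* With L = 1 + l, the tangent bound at L - x reads 1 - x + x^2 / (2 L) <= exp(- x). Averaging gives
   1 - D + E[x^2] / (2 L) <= 1. *)
have VD : \sum_k w k * x k ^+ 2 <= 2 * (1 + l) * D.
  have := wsum (fun k => 1 - x k + x k ^+ 2 / (2 * (1 + l)))
    (fun k => expR (- x k)).
  move=> /(_ _)/wrap[].
    move=> k /xl xk; have y1 : 1 <= 1 + l - x k by lra.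
    have := expR_sqr_tangent L1 y1.
    rewrite (_ : 1 + l - x k - (1 + l) = - x k); last by ring.
    apply: le_trans; rewrite le_eqVlt; apply/orP; left; apply/eqP.
    by field; apply/eqP => ?; lra.
  move=> /le_trans/(_ wexp).
  under eq_bigr => k _ do
    have -> : w k * (1 - x k + x k ^+ 2 / (2 * (1 + l))) =
      w k - w k * x k + w k * x k ^+ 2 / (2 * (1 + l)) by ring.
  rewrite big_split/= sumrB -mulr_suml w1 -/D => h.
  by rewrite mulrC -ler_pdivrMr; lra.
have m2 : m ^+ 2 = V + (1 + l - D) ^+ 2 by rewrite sqr_sqrtr// addr_ge0// sqr_ge0.
have mD : 1 + l - D <= m.
  by rewrite -(@ler_pXn2r _ 2)// ?nnegrE ?sqrtr_ge0 ?m2 ?lerDr//; lra.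
(* Expanding, m^2 = E[x^2] - 2 L D + L^2, so [VD] says exactly m^2 <= L^2. *)
have ml : m <= 1 + l.
  rewrite -(@ler_pXn2r _ 2)// ?nnegrE ?sqrtr_ge0 ?m2 /V//; last lra.
  by rewrite -subr_ge0; move: VD; set E := \sum_k _ => VD; nra.
have m0 : 0 < m by lra.
split.
  rewrite ler_pdivrMr; last lra.
  (* In this factorization the second factor is at most 2 m by [mD], and the first is at most [D] by
     [ml]. *)
  have -> : V = (m - (1 + l - D)) * (m + (1 + l - D)).
    by rewrite -subr_sqr m2 addrK.
  apply: le_trans (_ : (m - (1 + l - D)) * (2 * m) <= _).
    by rewrite ler_wpM2l; lra.
  by rewrite ler_wpM2r; lra.
by rewrite ler_wpM2l// lef_pV2 ?posrE; lra.
Qed.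

(** * Spectral theorem and functional calculus for Hermitian matrices *)

Lemma hermsymmx_conjdiag (R : realType) n (A : 'M[R[i]]_n) : A \is hermsymmx ->
  A = conjdiag (spectralmx A)
        (fun k => (complex.Re (spectral_diag A 0 k))%:C).
Proof.
move=> Ah; have /hermitian_normalmx/orthomx_spectralP {1}-> := Ah.
congr (invmx (spectralmx A) *m diag_mx _ *m spectralmx A).
apply/rowP => k; rewrite mxE RRe_real//.
by have /mxOverP := hermitian_spectral_diag_real Ah; apply.
Qed.

Lemma hermsymmx_diagonalizable (R : realType) n (A : 'M[R[i]]_n) :
  A \is hermsymmx -> exists U : 'M[R[i]]_n, exists a : 'I_n -> R,
    U \is unitarymx /\ A = conjdiag U (fun k => (a k)%:C).
Proof.
move=> /hermsymmx_conjdiag AE; exists (spectralmx A).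
by eexists; split; [exact: spectral_unitarymx|exact: AE].
Qed.

Lemma conjdiag_real_hermsymmx (R : realType) n (U : 'M[R[i]]_n) (a : 'I_n -> R) :
  U \is unitarymx -> conjdiag U (fun k => (a k)%:C) \is hermsymmx.
Proof.
move=> Uu; apply/is_hermitianmxP; rewrite expr0 scale1r.
rewrite /conjdiag invmx_unitary// !trmx_mul !map_mxM trmxCK tr_diag_mx.
rewrite map_diag_mx mulmxA; congr (U^t* *m diag_mx _ *m U).
by apply/rowP => k; rewrite !mxE; apply/esym/conjc_real.
Qed.

(** Frees [mxfun] from the basis chosen by [spectralmx]: it can be computed in any unitary
    eigenbasis. *)
Lemma mxfun_conjdiag (R : realType) n (f : R -> R) (U : 'M[R[i]]_n)
    (a : 'I_n -> R) :
  U \is unitarymx ->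
  mxfun f (conjdiag U (fun k => (a k)%:C)) = conjdiag U (fun k => (f (a k))%:C).
Proof.
move=> Uu; have Ah := conjdiag_real_hermsymmx a Uu.
have := hermsymmx_conjdiag Ah; set A := conjdiag U _ => AV.
(* [f] is extended to [R[i]] through the real part, which changes nothing on real eigenvalues. *)
have := conjdiag_comp (fun z => (f (complex.Re z))%:C)
  (unitarymx_unit Uu) (spectral_unit A) AV.
rewrite /comp /= => ->; rewrite /mxfun /conjdiag.
congr (invmx (spectralmx A) *m diag_mx _ *m spectralmx A).
by apply/rowP => k; rewrite !mxE.
Qed.

(** * Real traces and real overlaps *)

Lemma RtrD (R : realType) n (A B : 'M[R[i]]_n) : Rtr (A + B) = Rtr A + Rtr B.
Proof. by rewrite /Rtr mxtraceD; case: (\tr A) (\tr B) => [a b] []. Qed.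

Lemma RtrZ (R : realType) n (a : R) (A : 'M[R[i]]_n) :
  Rtr (a%:C *: A) = a * Rtr A.
Proof.
by rewrite /Rtr mxtraceZ; case: (\tr A) => x y /=; rewrite mul0r subr0.
Qed.

Lemma RtrN (R : realType) n (A : 'M[R[i]]_n) : Rtr (- A) = - Rtr A.
Proof. by rewrite /Rtr raddfN /=; case: (\tr A). Qed.

Lemma Re_sum (R : realType) (I : finType) (F : I -> R[i]) :
  complex.Re (\sum_i F i) = \sum_i complex.Re (F i).
Proof. by apply: (big_morph _ (id1 := 0) (op1 := +%R)) => // [] [? ?] []. Qed.

Lemma Rtr_conjdiag (R : realType) n (U : 'M[R[i]]_n) (a : 'I_n -> R) :
  U \is unitarymx -> Rtr (conjdiag U (fun k => (a k)%:C)) = \sum_k a k.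
Proof.
by move=> /unitarymx_unit Uu; rewrite /Rtr mxtrace_conjdiag// Re_sum.
Qed.

(** The squared modulus of the inner product of basis vectors [i] and [j]. It is already real, and
    the real part only moves it from [R[i]] to [R]. *)
Definition overlap (R : realType) n (U V : 'M[R[i]]_n) (i j : 'I_n) : R :=
  complex.Re (`|(U *m V^t*) i j| ^+ 2).

Lemma overlapE (R : realType) n (U V : 'M[R[i]]_n) i j :
  (overlap U V i j)%:C = `|(U *m V^t*) i j| ^+ 2.
Proof. by rewrite /overlap RRe_real// ger0_real// exprn_ge0. Qed.

Lemma overlap_ge0 (R : realType) n (U V : 'M[R[i]]_n) i j :
  0 <= overlap U V i j.
Proof. by rewrite -ler0c overlapE exprn_ge0. Qed.

Lemma sum_overlap_row (R : realType) n (U V : 'M[R[i]]_n) i :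
  U \is unitarymx -> V \is unitarymx -> \sum_j overlap U V i j = 1.
Proof.
move=> Uu Vu.
rewrite -[RHS](congr1 (@complex.Re R) (sum_overlap_sqr_row i Uu Vu)).
exact/esym/Re_sum.
Qed.

Lemma sum_overlap_col (R : realType) n (U V : 'M[R[i]]_n) j :
  U \is unitarymx -> V \is unitarymx -> \sum_i overlap U V i j = 1.
Proof.
move=> Uu Vu.
rewrite -[RHS](congr1 (@complex.Re R) (sum_overlap_sqr_col j Uu Vu)).
exact/esym/Re_sum.
Qed.

Lemma Rtr_conjdiagM (R : realType) n (U V : 'M[R[i]]_n) (a b : 'I_n -> R) :
  U \is unitarymx -> V \is unitarymx ->
  Rtr (conjdiag U (fun k => (a k)%:C) *m conjdiag V (fun k => (b k)%:C)) =
    \sum_i \sum_j overlap U V i j * (a i * b j).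
Proof.
move=> Uu Vu; rewrite /Rtr (mxtrace_conjdiagM _ _ Uu Vu) Re_sum.
apply: eq_bigr => i _.
rewrite Re_sum; apply: eq_bigr => j _.
by rewrite -overlapE -!rmorphM.
Qed.

Lemma Rtr_conjdiag_overlap (R : realType) n (U V : 'M[R[i]]_n) (a : 'I_n -> R) :
  U \is unitarymx -> V \is unitarymx ->
  Rtr (conjdiag U (fun k => (a k)%:C)) =
    \sum_i \sum_j overlap U V i j * a i.
Proof.
move=> Uu Vu; rewrite (Rtr_conjdiag _ Uu); apply: eq_bigr => i _.
by rewrite -mulr_suml (sum_overlap_row _ Uu Vu) mul1r.
Qed.

Lemma conjdiag_realM (R : realType) n (U : 'M[R[i]]_n) (a b : 'I_n -> R) :
  U \in unitmx ->
  conjdiag U (fun k => (a k)%:C) *m conjdiag U (fun k => (b k)%:C) =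
    conjdiag U (fun k => (a k * b k)%:C).
Proof.
move=> Uu; rewrite (conjdiagM _ _ Uu); apply: eq_conjdiag => k.
by rewrite rmorphM.
Qed.

Lemma conjdiag_realZ (R : realType) n (U : 'M[R[i]]_n) (c : R) (a : 'I_n -> R) :
  c%:C *: conjdiag U (fun k => (a k)%:C) = conjdiag U (fun k => (c * a k)%:C).
Proof. by rewrite conjdiagZ; apply: eq_conjdiag => k; rewrite rmorphM. Qed.

Lemma conjdiag_real_affine (R : realType) n (U : 'M[R[i]]_n) (c b : R)
    (a : 'I_n -> R) : U \in unitmx ->
  c%:C *: conjdiag U (fun k => (a k)%:C) + b%:C%:M =
    conjdiag U (fun k => (c * a k + b)%:C).
Proof.
move=> Uu; rewrite conjdiag_realZ -(conjdiag_const _ Uu) conjdiagD.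
by apply: eq_conjdiag => k; rewrite rmorphD.
Qed.

(** * Relative entropy and its variance as moments over pairs of eigenvectors *)

Lemma state_conjdiag (R : realType) n (rho : 'M[R[i]]_n) : is_state rho ->
  exists U : 'M[R[i]]_n, exists p : 'I_n -> R,
    [/\ U \is unitarymx, rho = conjdiag U (fun k => (p k)%:C),
        forall k, 0 <= p k & \sum_k p k = 1].
Proof.
case=> /hermsymmx_diagonalizable[U [p [Uu rhoE]]] rho0 rho1.
exists U, p; split=> // [k|]; last first.
  by rewrite -(Rtr_conjdiag _ Uu) -rhoE /Rtr rho1.
(* Positivity is tested on the [k]-th eigenvector, where the quadratic form equals [p k]. *)
have := rho0 ((row k U)^t*); rewrite trmxCK rhoE.
by rewrite (conjdiag_form _ _ Uu) ler0c.
Qed.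

Lemma rel_entropy_conjdiag (R : realType) n (U V : 'M[R[i]]_n)
    (p s : 'I_n -> R) : U \is unitarymx -> V \is unitarymx ->
  rel_entropy (conjdiag U (fun k => (p k)%:C)) (conjdiag V (fun k => (s k)%:C)) =
    \sum_i \sum_j overlap U V i j * (p i * (ln (p i) - ln (s j))).
Proof.
move=> Uu Vu; rewrite /rel_entropy /mxln !mxfun_conjdiag// mulmxBr RtrD RtrN.
rewrite (conjdiag_realM _ _ (unitarymx_unit Uu)) (Rtr_conjdiag_overlap _ Uu Vu).
rewrite (Rtr_conjdiagM _ _ Uu Vu) -sumrB.
apply: eq_bigr => i _; rewrite -sumrB; apply: eq_bigr => j _.
by ring.
Qed.

Lemma second_moment_conjdiag (R : realType) n (U V : 'M[R[i]]_n)
    (p s : 'I_n -> R) : U \is unitarymx -> V \is unitarymx ->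
  let rho := conjdiag U (fun k => (p k)%:C) in
  let sigma := conjdiag V (fun k => (s k)%:C) in
  Rtr (rho *m ((mxln rho - mxln sigma) *m (mxln rho - mxln sigma))) =
    \sum_i \sum_j overlap U V i j * (p i * (ln (p i) - ln (s j)) ^+ 2).
Proof.
move=> Uu Vu /=; rewrite /mxln (mxfun_conjdiag _ _ Uu) (mxfun_conjdiag _ _ Vu).
rewrite /Rtr (mxtrace_conjdiag_sqrB _ _ _ Uu Vu) Re_sum; apply: eq_bigr => i _.
rewrite Re_sum; apply: eq_bigr => j _.
by rewrite -overlapE -rmorphB -rmorphXn -!rmorphM.
Qed.

Lemma rel_variance_bounds (R : realType) n (U V : 'M[R[i]]_n)
    (p s : 'I_n -> R) (x : R) : U \is unitarymx -> V \is unitarymx ->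
  (forall i, 0 <= p i) -> \sum_i p i = 1 -> \sum_j s j = 1 ->
  0 < x -> x <= 1 -> (forall j, x <= s j) ->
  let rho := conjdiag U (fun k => (p k)%:C) in
  let sigma := conjdiag V (fun k => (s k)%:C) in
  rel_variance rho sigma / (2 * Num.sqrt (M2 x rho sigma)) <=
    rel_entropy rho sigma /\
  rel_variance rho sigma / (2 * (1 - ln x)) <=
    rel_variance rho sigma / (2 * Num.sqrt (M2 x rho sigma)).
Proof.
move=> Uu Vu p0 p1 s1 x0 x1 xs rho sigma.
pose w (k : 'I_n * 'I_n) := overlap U V k.1 k.2 * p k.1.
pose y (k : 'I_n * 'I_n) := ln (p k.1) - ln (s k.2).
have s0 j : 0 < s j by exact: lt_le_trans (xs j).
have p_le1 i : p i <= 1.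
  by rewrite -p1 (bigD1 i)//= lerDl sumr_ge0.
have wsum f : \sum_k w k * f k =
    \sum_i \sum_j overlap U V i j * (p i * f (i, j)).
  rewrite pair_bigA; apply: eq_bigr => -[i j] _ /=.
  by rewrite /w /= mulrA.
have DE : rel_entropy rho sigma = \sum_k w k * y k.
  by rewrite wsum rel_entropy_conjdiag.
have VE : rel_variance rho sigma =
    \sum_k w k * y k ^+ 2 - (\sum_k w k * y k) ^+ 2.
  rewrite /rel_variance DE (wsum (fun k => y k ^+ 2)); congr (_ - _).
  exact: (second_moment_conjdiag p s Uu Vu).
have w0 k : 0 <= w k by rewrite mulr_ge0 ?overlap_ge0.
have w1 : \sum_k w k = 1.
  transitivity (\sum_k w k * 1); first by apply: eq_bigr => k _; rewrite mulr1.
  rewrite (wsum (fun=> 1)) -[RHS]p1; apply: eq_bigr => i _.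
  by rewrite -mulr_suml (sum_overlap_row _ Uu Vu) mul1r mulr1.
have l0 : 0 <= - ln x by rewrite oppr_ge0 ln_le0.
(* The bound [ln p <= 0] also covers a zero eigenvalue, because [ln 0 = 0]. *)
have yl k : w k != 0 -> y k <= - ln x.
  move=> _; have lnp : ln (p k.1) <= 0 by exact: ln_le0.
  have lns : ln x <= ln (s k.2) by rewrite ler_ln ?posrE.
  by rewrite /y lerBlDr (le_trans lnp)// addrC subr_ge0.
(* If p_i > 0, then p_i exp(- y) = s_j; if p_i = 0, the left side is 0 < s_j. Summing over i first
   uses that the overlaps in a column add up to 1. *)
have wexp : \sum_k w k * expR (- y k) <= 1.
  rewrite wsum -[leRHS]s1 exchange_big /=; apply: ler_sum => j _.
  apply: le_trans (_ : \sum_i overlap U V i j * s j <= _); last first.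
    by rewrite -mulr_suml sum_overlap_col// mul1r.
  apply: ler_sum => i _; rewrite ler_wpM2l ?overlap_ge0//.
  rewrite /y /=; have [->|pi0] := eqVneq (p i) 0; first by rewrite mul0r ltW.
  have pi_gt0 : 0 < p i by rewrite lt_neqAle eq_sym pi0 p0.
  by rewrite opprB expRB !lnK ?posrE// mulrC mulfVK.
have := exp_moment_variance_bounds w0 w1 l0 yl wexp.
by rewrite /= -VE -DE /M2.
Qed.

(** * Gibbs states and the entropy inequalities *)

Lemma gibbs_conjdiag (R : realType) n (H : 'M[R[i]]_n) (beta : R)
    (V : 'M[R[i]]_n) (h : 'I_n -> R) :
  V \is unitarymx -> H = conjdiag V (fun k => (h k)%:C) ->
  partition_fun H beta = \sum_k expR (- beta * h k) /\
  gibbs H beta =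
    conjdiag V (fun k => (expR (- beta * h k) / partition_fun H beta)%:C).
Proof.
move=> Vu HE.
have expE : mxexp ((- beta)%:C *: H) =
    conjdiag V (fun k => (expR (- beta * h k))%:C).
  rewrite /mxexp HE conjdiag_realZ; exact: (mxfun_conjdiag _ _ Vu).
split; first by rewrite /partition_fun expE (Rtr_conjdiag _ Vu).
rewrite /gibbs expE conjdiag_realZ; apply: eq_conjdiag => k.
by rewrite mulrC.
Qed.

(** For a Gibbs state [c] is [ln Z]. Both traces being 1, it enters the entropy of [sigma] and the
    relative entropy equally and cancels. *)
Lemma vn_entropy_sub (R : realType) n (H rho sigma : 'M[R[i]]_n) (beta c : R) :
  mxln sigma = (- beta)%:C *: H + (- c)%:C%:M -> Rtr rho = 1 -> Rtr sigma = 1 ->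
  vn_entropy sigma - vn_entropy rho =
    beta * (expectation H sigma - expectation H rho) + rel_entropy rho sigma.
Proof.
rewrite /vn_entropy /rel_entropy; move: (mxln sigma) (mxln rho) => Y X YE.
move=> rho1 sigma1.
have RtrE A : Rtr (A *m Y) = - beta * expectation H A - c * Rtr A.
  rewrite YE mulmxDr -scalemxAr mul_mx_scalar RtrD !RtrZ.
  by rewrite [- c * _]mulNr.
rewrite mulmxBr RtrD RtrN !RtrE rho1 sigma1.
by ring.
Qed.

Theorem mainTheorem11 (R : realType) (n : nat) (H rho : 'M[R[i]]_n)
    (Emax kB T beta : R)
    (hH : H \is hermsymmx)
    (hEmax : is_max_eigenvalue H Emax)
    (hbeta : beta = 1 / (kB * T))
    (hbeta0 : 0 < beta)
    (hrho : is_state rho)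
    (hcomm : comm_mx rho (gibbs H beta)) :
  let gamma := gibbs H beta in
  let smin := expR (- (beta * Emax)) / partition_fun H beta in
  let dE := 1 / (kB * T) * (expectation H gamma - expectation H rho) in
  [/\ is_min_eigenvalue gamma smin,
      vn_entropy gamma - vn_entropy rho >=
        dE + rel_variance rho gamma / (2 * Num.sqrt (M2 smin rho gamma))
    & dE + rel_variance rho gamma / (2 * Num.sqrt (M2 smin rho gamma)) >=
        dE + rel_variance rho gamma
             / (2 + 2 * beta * (Emax - free_energy H beta))].
Proof.
move=> gamma smin dE.
have [U [p [Uu rhoE p0 p1]]] := state_conjdiag hrho.
have [V [h [Vu HE]]] := hermsymmx_diagonalizable hH.
have Vv := unitarymx_unit Vu.
have [] := gibbs_conjdiag beta Vu HE; rewrite -/gamma.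
set Z := partition_fun H beta => ZE gammaE.
(* The index [k0] with [h k0 = Emax] also shows that the sum defining [Z] is nonempty, hence
   positive, and it attains [smin]. *)
have [] := hEmax; rewrite {1}HE.
move=> /(eigenvalue_conjdiag _ _ Vv)[k0 /complexI EmaxE] Emax_ge.
have hmax k : h k <= Emax.
  by rewrite -lecR Emax_ge// HE; apply/(eigenvalue_conjdiag _ _ Vv); exists k.
have Z0 : 0 < Z.
  rewrite ZE (bigD1 k0)//= ltr_pwDl ?expR_gt0// sumr_ge0// => k _.
  exact: expR_ge0.
pose s k := expR (- beta * h k) / Z.
have s0 k : 0 < s k by rewrite divr_gt0 ?expR_gt0.
have s1 : \sum_k s k = 1 by rewrite -mulr_suml -ZE divff// gt_eqF.
have sminE : smin = s k0 by rewrite /smin /s EmaxE mulNr.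
have smin_le k : smin <= s k.
  by rewrite ler_pM2r ?invr_gt0// ler_expR mulNr lerN2 ler_pM2l.
have smin0 : 0 < smin by rewrite sminE.
have smin1 : smin <= 1.
  by rewrite sminE -s1 (bigD1 k0)//= lerDl sumr_ge0// => k _; exact: ltW.
have ln_s k : ln (s k) = - beta * h k - ln Z.
  by rewrite ln_div ?posrE ?expR_gt0// expRK.
have ln_smin : ln smin = - beta * Emax - ln Z by rewrite sminE ln_s EmaxE.
have ln_gamma : mxln gamma = (- beta)%:C *: H + (- ln Z)%:C%:M.
  rewrite gammaE /mxln (mxfun_conjdiag _ _ Vu) HE.
  rewrite (conjdiag_real_affine _ _ _ Vv); apply: eq_conjdiag => k.
  exact: (congr1 (real_complex R) (ln_s k)).
have Rtr_rho : Rtr rho = 1 by rewrite rhoE (Rtr_conjdiag _ Uu).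
have Rtr_gamma : Rtr gamma = 1 by rewrite gammaE (Rtr_conjdiag _ Vu).
have DE : vn_entropy gamma - vn_entropy rho = dE + rel_entropy rho gamma.
  by rewrite /dE -hbeta; exact: vn_entropy_sub ln_gamma Rtr_rho Rtr_gamma.
have [] := rel_variance_bounds Uu Vu p0 p1 s1 smin0 smin1 smin_le.
rewrite -rhoE -gammaE => first_bound second_bound; split.
- split.
    by rewrite gammaE sminE; apply/(eigenvalue_conjdiag _ _ Vv); exists k0.
  move=> a; rewrite gammaE => /(eigenvalue_conjdiag _ _ Vv)[k ->].
  by rewrite lecR; exact: smin_le.
- by rewrite DE lerD2l.
(* The free energy satisfies - beta F = ln Z, so both sides equal 2 + 2 beta Emax + 2 ln Z. *)
- rewrite lerD2l; suff -> : 2 + 2 * beta * (Emax - free_energy H beta) =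
    2 * (1 - ln smin) by [].
  rewrite ln_smin /free_energy -/Z; field.
  by rewrite gt_eqF.
Qed.
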